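(* Let $\alpha>1$ and let $n$ be prime. Fix $d\ge1$ and let nonnegative weights $\{\gamma_{\mathfrak u}\}$ with $\gamma_\emptyset=1$ be given. Let $\boldsymbol z\in\{1,\ldots,n-1\}^d$ be a generating vector obtained from the component-by-component (CBC) construction (defined in the context) for these $n$, $d$, $\alpha$ and the weights $\{\gamma_{\mathfrak u}\}_{\mathfrak u\subseteq\{1,\ldots,d\}}$. Then for all $\lambda\in(\frac1\alpha,1]$, $$S_d(\boldsymbol z)\le\bigg[\frac\tau n\bigg(\sum_{\emptyset\ne\mathfrak u\subseteq\{1,\ldots,d\}}|\mathfrak u|\,\gamma_{\mathfrak u}^\lambda\,[2\zeta(\alpha\lambda)]^{|\mathfrak u|}\bigg)\bigg(\sum_{\mathfrak u\subseteq\{1,\ldots,d\}}\gamma_{\mathfrak u}^\lambda\,[2\zeta(\alpha\lambda)]^{|\mathfrak u|}\bigg)\bigg]^{1/\lambda},$$ where $\tau:=\max(6,\,2.5+2^{2\alpha\lambda+1})$. Furthermore, if (the weights being given for all finite $\mathfrak u\subset\mathbb N$) there exists a constant $\xi\ge1$, which may depend on $\lambda$, such that $$\gamma_{\mathfrak u\cup\mathfrak w}^\lambda\le\xi\,\frac{\gamma_{\mathfrak u}^\lambda}{[2\zeta(\alpha\lambda)]^{|\mathfrak w|}}\quad\text{for all }\mathfrak u\subseteq\{1,\ldots,s\},\ \mathfrak w\subseteq\{s+1,\ldots,d'\},\ s\ge1,\ d'\ge1,$$ then $$S_d(\boldsymbol z)\le\bigg[\frac{\tau\,\xi}n\bigg(\sum_{\emptyset\ne\mathfrak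 u\subseteq\{1,\ldots,d\}}\gamma_{\mathfrak u}^\lambda\,[2\zeta(\alpha\lambda)]^{|\mathfrak u|}\bigg)\bigg(\sum_{\mathfrak u\subseteq\{1,\ldots,d\}}\gamma_{\mathfrak u}^\lambda\,[2\zeta(\alpha\lambda)]^{|\mathfrak u|}\bigg)\bigg]^{1/\lambda}.$$
   Context: Notation: $\mathbb N=\{1,2,\ldots\}$; $\zeta(x)=\sum_{h\ge1}h^{-x}$ is the Riemann zeta function; $\equiv_n$ is congruence modulo $n$; $\mathrm{supp}(\boldsymbol h)=\{j:h_j\ne0\}$; $\{s+1,\ldots,d\}$ is empty if $s\ge d$. For an integer vector $\boldsymbol h$ let $r'(\boldsymbol h)=\prod_{j\in\mathrm{supp}(\boldsymbol h)}|h_j|^\alpha$ and $r(\boldsymbol h)=r'(\boldsymbol h)/\gamma_{\mathrm{supp}(\boldsymbol h)}$, so that $1/r(\boldsymbol h)=\gamma_{\mathrm{supp}(\boldsymbol h)}/r'(\boldsymbol h)$ (which is $0$ if the weight is $0$). Error criterion: $$S_d(\boldsymbol z)=\sum_{\boldsymbol h\in\mathbb Z^d}\frac1{r(\boldsymbol h)}\sum_{\boldsymbol\ell\in\mathbb Z^d\setminus\{\boldsymbol0\},\ \boldsymbol\ell\cdot\boldsymbol z\equiv_n0}\frac1{r(\boldsymbol h+\boldsymbol\ell)}.$$ CBC construction: for $s\ge1$, integers $z_1,\ldots,z_s$ and nonnegative numbers $\{\beta_{\mathfrak u}\}_{\mathfrak u\subseteq\{1,\ldots,s\}}$ put $$\theta_s(z_1,\ldots,z_s;\{\beta_{\mathfrak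 u}\}_{\mathfrak u\subseteq\{1,\ldots,s\}})=\sum_{\boldsymbol h\in\mathbb Z^s}\ \sum_{\boldsymbol\ell\in\mathbb Z^s,\ \ell_s\ne0,\ \boldsymbol\ell\cdot(z_1,\ldots,z_s)\equiv_n0}\frac{\beta_{\mathrm{supp}(\boldsymbol h)}}{r'(\boldsymbol h)}\,\frac{\beta_{\mathrm{supp}(\boldsymbol h+\boldsymbol\ell)}}{r'(\boldsymbol h+\boldsymbol\ell)},$$ and for $1\le s\le d$ $$T_{d,s}(z_1,\ldots,z_s)=\sum_{\mathfrak w\subseteq\{s+1,\ldots,d\}}[2\zeta(2\alpha)]^{|\mathfrak w|}\,\theta_s(z_1,\ldots,z_s;\{\gamma_{\mathfrak u\cup\mathfrak w}\}_{\mathfrak u\subseteq\{1,\ldots,s\}}),$$ where the $\theta_s$ in the sum is evaluated with $\beta_{\mathfrak u}=\gamma_{\mathfrak u\cup\mathfrak w}$. A vector $\boldsymbol z=(z_1,\ldots,z_d)$ is obtained from the CBC construction if, for each $s=1,\ldots,d$ in turn, with $z_1,\ldots,z_{s-1}$ already fixed, $z_s$ is chosen in $\{1,\ldots,n-1\}$ to minimize $T_{d,s}(z_1,\ldots,z_{s-1},\,\cdot\,)$. *)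

(* Defs.v *)
From HB Require Import structures.
From mathcomp Require Import all_boot all_order all_algebra.
From mathcomp Require Import finmap.
From mathcomp Require Import all_classical all_reals all_analysis.

Set Implicit Arguments.
Unset Strict Implicit.
Unset Printing Implicit Defensive.

Import Order.TTheory GRing.Theory Num.Theory.
Import numFieldNormedType.Exports.
Local Open Scope classical_set_scope.
Local Open Scope ring_scope.

(* Coordinates are numbered 1, ..., d when they occur in a finite set
   u : {fset nat}: the entry of a row vector at j : 'I_d has number j.+1. *)

(* {a+1, ..., b}, empty if b <= a *)
Definition irange (a b : nat) : {fset nat} :=
  [fset j in index_iota a.+1 b.+1]%fset.

Definition supp (s : nat) (h : 'rV[int]_s) : {fset nat} :=
  [fset (val j).+1 | j in 'I_s & h 0 j != 0]%fset.

Definition dotz (s : nat) (l z : 'rV[int]_s) : int := \sum_j l 0 j * z 0 j.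

Definition zeta (R : realType) (x : R) : R := limn (series (riemannR x)).

Definition r' (R : realType) (alpha : R) (s : nat) (h : 'rV[int]_s) : R :=
  \prod_(j < s | h 0 j != 0) (`|h 0 j|%:~R `^ alpha).

(* If the weight is 0 then r = 0 and r^-1 = 0, so that
   r^-1 = gamma (supp h) / r' in all cases. *)
Definition r (R : realType) (alpha : R) (gamma : {fset nat} -> R)
    (s : nat) (h : 'rV[int]_s) : R :=
  r' alpha h / gamma (supp h).

Definition S_err (R : realType) (alpha : R) (gamma : {fset nat} -> R)
    (n d : nat) (z : 'rV[int]_d) : \bar R :=
  (\esum_(h in [set: 'rV[int]_d])
     ((r alpha gamma h)^-1%:E *
      \esum_(l in [set l : 'rV[int]_d |
                    (l <> 0)%R /\ (dotz l z = 0 %[mod n%:Z])%Z])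
        (r alpha gamma (h + l)%R)^-1%:E))%E.

(* theta in dimension s.+1; ord_max is the last coordinate. *)
Definition theta (R : realType) (alpha : R) (n s : nat) (z : 'rV[int]_s.+1)
    (beta : {fset nat} -> R) : \bar R :=
  (\esum_(h in [set: 'rV[int]_s.+1])
     \esum_(l in [set l : 'rV[int]_s.+1 |
                   (l 0 ord_max <> 0)%R /\ (dotz l z = 0 %[mod n%:Z])%Z])
       ((beta (supp h) / r' alpha h) *
        (beta (supp (h + l)%R) / r' alpha (h + l)%R))%:E)%E.

(* T_{d,s+1}(z_1, ..., z_{s+1}) *)
Definition T_cbc (R : realType) (alpha : R) (gamma : {fset nat} -> R)
    (n d s : nat) (z : 'rV[int]_s.+1) : \bar R :=
  (\sum_(w <- fpowerset (irange s.+1 d))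
     ((2 * zeta (2 * alpha)) ^+ #|` w|)%:E *
     theta alpha n z (fun u => gamma (u `|` w)%fset))%E.

(* (z_1, ..., z_s, c), for s < d *)
Definition cbc_prefix (d : nat) (z : 'rV[int]_d) (s : 'I_d) (c : int) :
    'rV[int]_s.+1 :=
  \row_(j < s.+1) (if j == ord_max then c else z 0 (widen_ord (ltn_ord s) j)).

Definition is_cbc (R : realType) (alpha : R) (gamma : {fset nat} -> R)
    (n d : nat) (z : 'rV[int]_d) : Prop :=
  forall s : 'I_d,
    (1 <= z 0 s < n%:Z) /\
    (forall c : int, 1 <= c < n%:Z ->
       (T_cbc alpha gamma n d (cbc_prefix z s (z 0 s)%R) <=
        T_cbc alpha gamma n d (cbc_prefix z s c))%E).

Definition tau (R : realType) (alpha lambda : R) : R :=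
  Num.max 6 (5 / 2 + 2 `^ (2 * alpha * lambda + 1)).

(* Main.v *)
(* Splitting the nonzero dual vectors l by their last nonzero coordinate s and
   writing k = h + l gives S_d = sum_s T_{d,s}(z_1, ..., z_s), where T_{d,s} is a
   sum of f(h) f(k), f = 1/r, over pairs h, k in Z^d which agree after s, differ
   at s, and satisfy (k - h).z = 0 mod n.  By the subadditivity of x |-> x^lambda,
   T_{d,s}^lambda is at most the same sum for alpha lambda and gamma^lambda, and
   the minimum over z_s of the latter is at most its average.  In the average, a
   pair with n not dividing k_s - h_s is counted at most once among n - 1 choices
   of z_s; the pairs with k_s - h_s = n m contribute little because
     f(h) f(k) <= 2^alpha n^-alpha (f(h) f(k') + f(h') f(k)),
   the primes meaning that the s-th entry is replaced by m: one of |h_s|, |k_s| is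
   at least n |m| / 2.  Both parts are bounded by F F_s, with F = sum_h f(h) and
   F_s any bound, uniform in k, for the sum of f(h) over the h with h_s <> 0 which
   agree with k after s.  The two estimates of the theorem come from two choices
   of F_s: dropping the agreement with k, or replacing the entries of h after s by
   zeros by means of the hypothesis with xi. *)

Require Import Defs.
From HB Require Import structures.
From mathcomp Require Import all_boot all_order all_algebra.
From mathcomp Require Import finmap.
From mathcomp Require Import all_classical all_reals all_analysis.
From mathcomp Require Import ring lra.

Set Implicit Arguments.
Unset Strict Implicit.
Unset Printing Implicit Defensive.

Import Order.TTheory GRing.Theory Num.Theory.
Import numFieldNormedType.Exports.
Local Open Scope classical_set_scope.
Local Open Scope ring_scope.


(** * Sums of nonnegative families *)

Lemma subset_esum (R : realType) (T : choiceType) (A B : set T) (g : T -> \bar R) :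
  A `<=` B -> (\esum_(i in A) g i <= \esum_(i in B) g i)%E.
Proof.
move=> AB; apply: le_ereal_sup => _ [X [finX XA] <-].
by exists X => //; split => // i /XA /AB.
Qed.

(** One inequality, valid for every nonnegative constant, is applied to [c] and then to its inverse;
    [c = 0] is treated apart. *)
Lemma esumZl (R : realType) (T : choiceType) (D : set T) (c : R) (g : T -> \bar R) :
  0 <= c -> (forall i, D i -> (0 <= g i)%E) ->
  (\esum_(i in D) (c%:E * g i) = c%:E * \esum_(i in D) g i)%E.
Proof.
have le_esumZ (k : R) (h : T -> \bar R) : 0 <= k -> (forall i, D i -> 0 <= h i)%E ->
    (\esum_(i in D) (k%:E * h i) <= k%:E * \esum_(i in D) h i)%E.
  move=> k0 h0; apply: ge_ereal_sup => _ [X [finX XD] <-].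
  rewrite fsbig_finite//= big_seq -ge0_sume_distrr; last first.
    by move=> i; rewrite in_fset_set// inE => /XD/h0.
  rewrite -big_seq lee_wpmul2l ?lee_fin//; apply: ereal_sup_ubound.
  by exists X => //; rewrite fsbig_finite.
move=> c0 g0; apply/eqP; rewrite eq_le le_esumZ//=.
have [->|cn0] := eqVneq c 0.
  by rewrite mul0e esum_ge0// => i Di; rewrite mul0e.
have cp : 0 < c by rewrite lt_neqAle eq_sym cn0.
rewrite -lee_pdivlMl//.
apply: (le_trans _ (le_esumZ c^-1 _ _ _)); rewrite ?invr_ge0//; last first.
  by move=> i Di; rewrite mule_ge0 ?lee_fin ?g0.
by apply: le_esum => i Di; rewrite muleA -EFinM mulVf// mul1e.
Qed.

Lemma esum_setU_le (R : realType) (T : choiceType) (A B : set T) (g : T -> \bar R) :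
  (forall i, (0 <= g i)%E) ->
  (\esum_(i in A `|` B) g i <= \esum_(i in A) g i + \esum_(i in B) g i)%E.
Proof.
move=> g0; rewrite (esumID A) => [|i _]; last exact: g0.
by rewrite leeD//; apply: subset_esum => i -[[]].
Qed.

Lemma esum_cover_le (R : realType) (T : choiceType) (I : finType) (D : set T)
    (E : I -> set T) (g : T -> \bar R) :
  (forall i, (0 <= g i)%E) ->
  (forall i, D i -> exists j, E j i) ->
  (\esum_(i in D) g i <= \sum_(j : I) \esum_(i in D `&` E j) g i)%E.
Proof.
move=> g0 DE.
under eq_bigr do rewrite esum_mkcondr.
rewrite -esum_sum => [|i j _ _]; last by case: ifP.
apply: le_esum => i /DE[j Eji].
rewrite (bigD1 j)//= mem_set// leeDl// sume_ge0// => k _; by case: ifP.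
Qed.

Lemma esum_partition (R : realType) (T K : choiceType) (r : seq K) (e : T -> K)
    (D : set T) (g : T -> \bar R) :
  uniq r -> (forall i, D i -> (0 <= g i)%E) -> (forall i, D i -> e i \in r) ->
  (\esum_(i in D) g i =
   \sum_(u <- r) \esum_(i in D `&` [set i | e i = u]) g i)%E.
Proof.
move=> ur g0 er.
under [RHS]eq_bigr do rewrite esum_mkcondr.
rewrite -esum_sum => [|i j /g0 gi0 _]; last by case: ifP.
apply: eq_esum => i Di.
rewrite (bigD1_seq (e i)) ?er//= mem_set// big1_seq ?adde0// => u /andP[ui _].
by rewrite memNset//= => eiu; rewrite eiu eqxx in ui.
Qed.

Lemma le_esum_inj (R : realType) (T T' : choiceType) (e : T -> T') (D : set T)
    (D' : set T') (g : T' -> \bar R) :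
  (forall x y, D x -> D y -> e x = e y -> x = y) -> (forall i, D i -> D' (e i)) ->
  (\esum_(i in D) g (e i) <= \esum_(j in D') g j)%E.
Proof.
move=> einj eD; rewrite -(@esum_image _ _ _ D e); last first.
  by move=> x y /[!inE]; exact: einj.
by apply: subset_esum => _ [i /eD ? <-].
Qed.

(** With s the whole sum, the ratios [F i / s] add up to 1, and each of them lies in [0, 1], so it
    is at most its own power with exponent [lam]. *)
Lemma le_powR_sum (R : realType) (lam : R) (I : eqType) (r : seq I) (F : I -> R) :
  0 < lam <= 1 -> (forall i, 0 <= F i) ->
  (\sum_(i <- r) F i) `^ lam <= \sum_(i <- r) F i `^ lam.
Proof.
move=> /andP[lam0 lam1] F0; set s := \sum_(i <- r) F i.
have [s0|sn0] := eqVneq s 0.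
  by rewrite s0 powR0 ?gt_eqF// sumr_ge0// => i _; exact: powR_ge0.
have s_gt0 : 0 < s by rewrite lt_neqAle eq_sym sn0 sumr_ge0.
rewrite -[leLHS]mulr1 -(divff sn0) {2}/s mulr_suml mulr_sumr.
rewrite big_seq [leRHS]big_seq; apply: ler_sum => i ir.
have [->|Fi0] := eqVneq (F i) 0; first by rewrite mul0r mulr0 powR_ge0.
rewrite -[in leRHS](divfK sn0 (F i)) powRM ?divr_ge0 ?(ltW s_gt0)//.
rewrite mulrC ler_wpM2r ?powR_ge0// ger1_powR//.
have Fi_gt0 : 0 < F i by rewrite lt_neqAle eq_sym Fi0 F0.
rewrite divr_gt0//= ler_pdivrMr// mul1r /s.
by rewrite (big_rem i)//= lerDl sumr_ge0.
Qed.

Lemma powRVK (R : realType) (lam x : R) : lam != 0 -> 0 <= x ->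
  (x `^ lam) `^ lam^-1 = x.
Proof. by move=> l0 x0; rewrite -powRrM mulfV// powRr1. Qed.

Lemma powRKV (R : realType) (lam x : R) : lam != 0 -> 0 <= x ->
  (x `^ lam^-1) `^ lam = x.
Proof. by move=> l0 x0; rewrite -powRrM mulVf// powRr1. Qed.

(** The sums over finite subsets are real, so subadditivity applies to each of them before the
    supremum is taken. *)
Lemma esum_powR_le (R : realType) (T : choiceType) (D : set T) (lam B : R)
    (F : T -> R) : 0 < lam <= 1 -> (forall i, 0 <= F i) ->
  (\esum_(i in D) (F i `^ lam)%:E <= B%:E)%E ->
  (\esum_(i in D) (F i)%:E <= (B `^ lam^-1)%:E)%E.
Proof.
move=> lam01 F0 FB; have /andP[lam0 _] := lam01.
apply: ge_ereal_sup => _ [X XD <-].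
have : (\sum_(i \in X) (F i `^ lam)%:E <= B%:E)%E.
  by apply: le_trans FB; apply: ereal_sup_ubound; exists X.
have [finX _] := XD.
rewrite !fsbig_finite// !sumEFin !lee_fin => XB.
rewrite -[leLHS](@powRVK _ lam) ?gt_eqF//; last by rewrite sumr_ge0.
rewrite ge0_ler_powR ?invr_ge0 ?(ltW lam0) ?nnegrE ?powR_ge0//.
  by apply: le_trans XB; rewrite sumr_ge0// => i _; exact: powR_ge0.
exact: le_trans (le_powR_sum _ lam01 F0) XB.
Qed.

(** * The zeta function as a sum over the nonzero integers *)

(** Serves to show that the series converges, so that the [limn] in [zeta] is a true limit. Since
    S_N <= S_(2N+1), the recursion bounds S_N by the solution of x = 1 + 2^(1-a) x. *)
Lemma series_riemannR_le (R : realType) (a : R) (N : nat) : 1 < a ->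
  series (riemannR a) N <= (1 - 2 `^ (1 - a))^-1.
Proof.
move=> a1; have a0 : 0 <= a by rewrite ltW// (lt_trans ltr01).
set q := 2 `^ (1 - a).
have q1 : q < 1.
  by rewrite /q -[ltRHS](powRr0 2) /powR pnatr_eq0 /= ltr_expR ltr_pM2r ?ln_gt0 ?ltr1n// subr_lt0.
(* Bounding the terms 2j and 2j + 1 by the former: S_(2M+1) <= 1 + 2^(1-a) S_M. *)
have rec M : series (riemannR a) M.*2.+1 <= 1 + q * series (riemannR a) M.
  elim: M => [|M IH].
    by rewrite /series/= big_nat1 big_geq// /riemannR powR1 invr1 mulr0 addr0.
  have step k : series (riemannR a) k.+1 = series (riemannR a) k + riemannR a k.
    by rewrite /series/= big_nat_recr.
  rewrite doubleS (step M.*2.+2) (step M.*2.+1) (step M) mulrDr.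
  rewrite -[leLHS]addrA [leRHS]addrA lerD//.
  rewrite /riemannR/=.
  have M1 : 2 * (M.*2.+2%:R `^ a)^-1 = q * (M.+1%:R `^ a)^-1 :> R.
    rewrite (_ : M.*2.+2%:R = 2 * M.+1%:R :> R); last first.
      by rewrite -doubleS -muln2 natrM mulrC.
    by rewrite powRM ?ler0n// invfM mulrA /q powRD ?pnatr_eq0 ?implybT// powRr1// powRN.
  rewrite -M1 mulr2n mulrDl mul1r lerD2l lef_pV2 ?posrE ?powR_gt0//.
  by rewrite ge0_ler_powR ?nnegrE ?ler_nat.
have mono : series (riemannR a) N <= series (riemannR a) N.*2.+1.
  rewrite /series/= [leRHS](@big_cat_nat _ _ _ N)//=; last by rewrite -addnn -addnS leq_addr.
  by rewrite lerDl sumr_ge0// => i _; exact/ltW/riemannR_gt0.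
have := le_trans mono (rec N).
rewrite -subr_ge0 => h; rewrite -[leRHS]mul1r ler_pdivlMr ?subr_gt0//; lra.
Qed.

(* 1/r(h) is gamma (supp h) times the product of the wt alpha h_j; see r'V and
   rinvE. *)
Definition wt (R : realType) (a : R) (x : int) : R :=
  if x == 0 then 1 else (`|x|%:~R `^ a)^-1.

Lemma wt0 (R : realType) (a : R) : wt a 0 = 1.
Proof. by rewrite /wt eqxx. Qed.

Lemma wt_ge0 (R : realType) (a : R) x : 0 <= wt a x.
Proof. by rewrite /wt; case: ifP => // _; rewrite invr_ge0 powR_ge0. Qed.

Lemma zetaE (R : realType) (a : R) : 1 < a ->
  (\esum_(k in [set: nat]) (riemannR a k)%:E = (zeta a)%:E)%E.
Proof.
move=> a1; have a0 : 0 <= a by rewrite ltW// (lt_trans ltr01).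
rewrite -nneseries_esumT => [|k]; last by rewrite lee_fin ltW// riemannR_gt0.
apply/cvg_lim => //; rewrite /zeta.
have cv : cvgn (series (riemannR a)).
  apply: nondecreasing_is_cvgn.
    by apply/nondecreasing_seqP => k; rewrite seriesSr// lerDl ltW// riemannR_gt0.
  exists (1 - 2 `^ (1 - a))^-1 => _ [k _ <-]; exact: series_riemannR_le.
under eq_cvg do rewrite sumEFin.
by apply/fine_cvgP; split => //; exact: nearW.
Qed.

Lemma esum_wt (R : realType) (a : R) : 1 < a ->
  (\esum_(x in [set x : int | x <> 0%R]) (wt a x)%:E = (2 * zeta a)%:E)%E.
Proof.
move=> a1; have a0 : 0 <= a by rewrite ltW// (lt_trans ltr01).
rewrite (esumID [set x : int | 0 <= x]) => [|x _]; last by rewrite lee_fin wt_ge0.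
rewrite mulr2n mulrDl mul1r EFinD -zetaE//; congr (_ + _)%E.
- rewrite (@reindex_esum _ _ _ [set: nat] _ (fun k => Posz k.+1)).
    by apply: eq_esum.
  split => //.
  - by move=> x y _ _ [].
  - by move=> [[|k]|k] [] //= _ _; exists k.
- rewrite (@reindex_esum _ _ _ [set: nat] _ (fun k => Negz k)).
    by apply: eq_esum.
  split => //.
  - by move=> x y _ _ [].
  - by move=> [[|k]|k] [] //= _ _; exists k.
Qed.

Lemma zeta2_ge1 (R : realType) (a : R) : 1 < a -> 1 <= 2 * zeta a.
Proof.
move=> a1; rewrite -lee_fin -esum_wt//.
apply: (@le_trans _ _ (\esum_(x in [set 1%Z]) (wt a x)%:E)%E).
  by rewrite esum_set1 ?lee_fin ?wt_ge0// /wt/= normr1 powR1 invr1.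
by apply: subset_esum => x ->.
Qed.

(** * Sums over integer vectors with prescribed support *)

Lemma mem_irange (a b i : nat) : (i \in irange a b) = (a < i <= b)%N.
Proof. by rewrite in_fset /= mem_index_iota ltnS. Qed.

Lemma in_supp (s : nat) (h : 'rV[int]_s) (j : 'I_s) :
  (j.+1 \in supp h) = (h 0 j != 0).
Proof.
apply/imfsetP/idP => [[k /=]|hj]; last by exists j; rewrite //= inE.
by rewrite inE => hk [/val_inj ->].
Qed.

Lemma suppP (s : nat) (h : 'rV[int]_s) (i : nat) :
  reflect (exists2 j : 'I_s, h 0 j != 0 & i = j.+1) (i \in supp h).
Proof.
apply: (iffP idP) => [/imfsetP[k /=]|[k hk ->]]; last by rewrite in_supp.
by rewrite inE => hk ->; exists k.
Qed.

Lemma supp_irange (s : nat) (h : 'rV[int]_s) : (supp h `<=` irange 0 s)%fset.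
Proof. by apply/fsubsetP => _ /suppP[j _ ->]; rewrite mem_irange ltn_ord. Qed.

Lemma supp_eq0 (s : nat) (h : 'rV[int]_s) : (supp h == fset0) = (h == 0).
Proof.
apply/eqP/eqP => [h0|->]; last first.
  by apply/fsetP => i; rewrite inE; apply/suppP => -[j]; rewrite mxE eqxx.
apply/rowP => j; rewrite mxE; apply/eqP; apply: contraT.
by rewrite -in_supp h0 inE.
Qed.

Lemma r'V (R : realType) (a : R) (s : nat) (h : 'rV[int]_s) :
  (r' a h)^-1 = \prod_j wt a (h 0 j).
Proof.
rewrite /r' big_mkcond -prodfV; apply: eq_bigr => j _.
by rewrite /wt; case: eqP => //= _; rewrite ?invr1.
Qed.

Lemma prod_wt_ge0 (R : realType) (a : R) (s : nat) (h : 'rV[int]_s) :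
  0 <= \prod_j wt a (h 0 j).
Proof. by apply: prodr_ge0 => j _; exact: wt_ge0. Qed.

Definition upd (d : nat) (h : 'rV[int]_d) (s : 'I_d) (x : int) : 'rV[int]_d :=
  \row_j (if j == s then x else h 0 j).

Lemma upd_eq (d : nat) (h : 'rV[int]_d) (s : 'I_d) (x : int) : upd h s x 0 s = x.
Proof. by rewrite mxE eqxx. Qed.

Lemma upd_ne (d : nat) (h : 'rV[int]_d) (s j : 'I_d) (x : int) :
  j != s -> upd h s x 0 j = h 0 j.
Proof. by rewrite mxE => /negPf ->. Qed.

Lemma upd_id (d : nat) (h : 'rV[int]_d) (s : 'I_d) : upd h s (h 0 s) = h.
Proof. by apply/rowP => j; rewrite mxE; case: eqP => [->|]. Qed.

Lemma supp_upd (d : nat) (h : 'rV[int]_d) (s : 'I_d) (x : int) :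
  x != 0 -> supp (upd h s x) = (s.+1 |` supp h)%fset.
Proof.
move=> x0; apply/fsetP => i; rewrite !inE; apply/suppP/orP.
  move=> [j]; have [->|js] := eqVneq j s; first by left; apply/eqP.
  by rewrite upd_ne// => hj ->; right; rewrite in_supp.
move=> [/eqP->|/suppP[j hj ->]]; first by exists s; rewrite ?upd_eq.
by exists j => //; have [->|js] := eqVneq j s; rewrite ?upd_eq// upd_ne.
Qed.

Lemma prod_wt_upd (R : realType) (a : R) (d : nat) (h : 'rV[int]_d) (s : 'I_d) x :
  \prod_j wt a (upd h s x 0 j) = wt a x * \prod_(j | j != s) wt a (h 0 j).
Proof.
rewrite (bigD1 s)//= upd_eq; congr (_ * _).
by apply: eq_bigr => j js; rewrite upd_ne.
Qed.

(** Induction on [u]: a vector with one more number in its support arises in exactly one way by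
    putting a nonzero integer at that coordinate, and summing over this integer gives one more
    factor [2 * zeta a]. *)
Lemma esum_supp_eq (R : realType) (a : R) (d : nat) (u : {fset nat}) :
  1 < a -> (u `<=` irange 0 d)%fset ->
  (\esum_(h in [set h : 'rV[int]_d | supp h = u]) (\prod_j wt a (h 0 j))%:E =
   ((2 * zeta a) ^+ #|` u|)%:E)%E.
Proof.
move=> a1; elim/fset1U_rect : u => [_|i v iv IH].
  rewrite (_ : [set h | _] = [set 0]); last first.
    apply/seteqP; split => [h /= /eqP|h /= ->]; first by rewrite supp_eq0 => /eqP.
    by apply/eqP; rewrite supp_eq0.
  rewrite esum_set1 ?lee_fin ?prod_wt_ge0// cardfs0 expr0 big1// => j _.
  by rewrite mxE wt0.
rewrite fsubUset fsub1set => /andP[+ vd]; rewrite mem_irange => /andP[i0 id].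
have is_ : (i.-1 < d)%N by rewrite -ltnS prednK.
pose s := Ordinal is_; have iE : i = s.+1 by rewrite /= prednK.
rewrite iE in iv *.
rewrite (@reindex_esum _ _ _ ([set x : int | x <> 0] `*`` (fun=> [set h : 'rV[int]_d | supp h = v]))
  _ (fun p => upd p.2 s p.1)); last first.
  split.
  - by move=> [x h] /= [/eqP x0 hv]; rewrite supp_upd// hv.
  - move=> [x h] [y k] /=; rewrite !inE/= => -[_ hv] [_ kv] e.
    have xy : x = y by have := congr1 (fun g : 'rV[int]_d => g 0 s) e; rewrite !upd_eq.
    congr (_, _) => //; apply/rowP => j.
    have [->|js] := eqVneq j s; last first.
      by have := congr1 (fun g : 'rV[int]_d => g 0 j) e; rewrite !upd_ne.
    have hs0 (g : 'rV[int]_d) : supp g = v -> g 0 s = 0.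
      by move=> gv; apply/eqP; apply: contraNT iv; rewrite -in_supp gv.
    by rewrite !hs0.
  - move=> h /= hv; exists (h 0 s, upd h s 0) => /=; last first.
      by apply/rowP => j; rewrite !mxE; case: eqP => [->|].
    split; first by apply/eqP; rewrite -in_supp hv !inE eqxx.
    apply/fsetP => k; apply/suppP/idP => [[j]|kv].
      have [->|js] := eqVneq j s; first by rewrite upd_eq.
      rewrite upd_ne// -in_supp hv !inE => + -> => /orP[/eqP[e]|//].
      by case/eqP: js; apply/val_inj.
    have : k \in supp h by rewrite hv !inE kv orbT.
    move=> /suppP[j hj kj]; exists j => //; rewrite upd_ne//.
    by apply: contraNneq iv => <-; rewrite -kj.
rewrite cardfsU1 iv/= add1n exprS EFinM.
transitivity (\esum_(x in [set x : int | x <> 0%R])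
    \esum_(h in [set h : 'rV[int]_d | supp h = v])
      ((\prod_j wt a (h 0 j))%:E * (wt a x)%:E))%E; last first.
  transitivity (\esum_(x in [set x : int | x <> 0%R])
     (((2 * zeta a) ^+ #|` v|)%:E * (wt a x)%:E))%E.
    apply: eq_esum => x _; under eq_esum do rewrite muleC.
    rewrite esumZl ?wt_ge0// => [|h _]; last by rewrite lee_fin prod_wt_ge0.
    by rewrite IH// muleC.
  rewrite esumZl ?esum_wt//; first by rewrite muleC.
    by rewrite exprn_ge0// (le_trans ler01)// zeta2_ge1.
  by move=> x _; rewrite lee_fin wt_ge0.
rewrite esum_esum => [|x h _ _]; last first.
  by rewrite mule_ge0// lee_fin ?wt_ge0// prod_wt_ge0.
apply: eq_esum => -[x h] [/= _ hv].
rewrite prod_wt_upd -EFinM [in RHS]mulrC [in RHS](bigD1 s)//=.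
have -> : h 0 s = 0 by apply/eqP; apply: contraNT iv; rewrite -in_supp hv.
by rewrite wt0 mul1r.
Qed.

(** The vectors are grouped by their support. The function [phi] is general because it will stand
    for the weights, for weights cut off to supports containing a given number, and in [T_cbcE] for
    a product of weights attached to a pair. *)
Lemma esum_supp (R : realType) (a : R) (d : nat) (J : {fset nat})
    (phi : {fset nat} -> R) :
  1 < a -> (J `<=` irange 0 d)%fset -> (forall u, 0 <= phi u) ->
  (\esum_(h in [set h : 'rV[int]_d | (supp h `<=` J)%fset])
      (phi (supp h) * \prod_j wt a (h 0 j))%:E =
   (\sum_(u <- fpowerset J) phi u * (2 * zeta a) ^+ #|` u|)%:E)%E.
Proof.
move=> a1 Jd phi0.
rewrite (@esum_partition _ _ _ (fpowerset J) (@supp d))//; last 2 first.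
- by move=> h _; rewrite lee_fin mulr_ge0// prod_wt_ge0.
- by move=> h hJ; rewrite fpowersetE.
rewrite -sumEFin big_seq [RHS]big_seq; apply: eq_bigr => u.
rewrite fpowersetE => uJ; rewrite EFinM -(@esum_supp_eq _ a d)//; last first.
  exact: fsubset_trans Jd.
rewrite -esumZl// => [|h _]; last by rewrite lee_fin prod_wt_ge0.
rewrite (_ : _ `&` _ = [set h : 'rV[int]_d | supp h = u]); last first.
  by apply/seteqP; split => h /= [// ->].
by apply: eq_esum => h /= ->; rewrite EFinM.
Qed.

(** * Sums over pairs of vectors *)

Definition agree (d : nat) (s : 'I_d) (h k : 'rV[int]_d) : Prop :=
  forall j : 'I_d, (s < j)%N -> h 0 j = k 0 j.

Definition pairs (d : nat) (s : 'I_d) : set ('rV[int]_d * 'rV[int]_d) :=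
  [set p | agree s p.1 p.2 /\ p.1 0 s <> p.2 0 s].

(* The pairs (h, h + l) in which l has its last nonzero entry at s and
   l.(z_1, ..., z_(s-1), c) = 0 mod n. *)
Definition dual_pairs (d n : nat) (z : 'rV[int]_d) (s : 'I_d) (c : int) :
    set ('rV[int]_d * 'rV[int]_d) :=
  [set p | pairs s p /\ (dotz (p.2 - p.1) (upd z s c) = 0 %[mod n%:Z])%Z].

(** The range of the sums that F_s bounds uniformly in [k]; the constant [F1] below plays the role
    of F_s. *)
Definition agree_nz (d : nat) (s : 'I_d) (k : 'rV[int]_d) : set 'rV[int]_d :=
  [set h | agree s k h /\ h 0 s <> 0].

Definition pairs_fst (d : nat) (s : 'I_d) : set ('rV[int]_d * 'rV[int]_d) :=
  [set p | agree s p.1 p.2 /\ p.1 0 s <> 0].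

Definition pairs_snd (d : nat) (s : 'I_d) : set ('rV[int]_d * 'rV[int]_d) :=
  [set p | agree s p.1 p.2 /\ p.2 0 s <> 0].

Definition pairs_dvd (d n : nat) (s : 'I_d) : set ('rV[int]_d * 'rV[int]_d) :=
  [set p | pairs s p /\ (n%:Z %| (p.2 0 s - p.1 0 s)%R)%Z].

Definition rinv (R : realType) (a : R) (gamma : {fset nat} -> R) (d : nat)
    (h : 'rV[int]_d) : R :=
  gamma (supp h) * \prod_j wt a (h 0 j).

Lemma rinv_ge0 (R : realType) (a : R) (gamma : {fset nat} -> R) (d : nat)
    (h : 'rV[int]_d) : (forall u, 0 <= gamma u) -> 0 <= rinv a gamma h.
Proof. by move=> g0; rewrite mulr_ge0// prod_wt_ge0. Qed.

Lemma wt_le (R : realType) (a : R) (n : nat) (x m : int) : 1 < a -> (0 < n)%N ->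
  m != 0 -> n%:Z * `|m| <= 2 * `|x| ->
  wt a x <= 2 `^ a * (n%:R `^ a)^-1 * wt a m.
Proof.
move=> a1 n0 m0 nmx; have a0 : 0 <= a by rewrite ltW// (lt_trans ltr01).
have x0 : x != 0.
  apply: contraTneq nmx => ->; rewrite normr0 mulr0 -ltNge.
  by rewrite mulr_gt0 ?normr_gt0// ltz_nat.
rewrite /wt (negPf x0) (negPf m0) -mulrA -invfM -powRM ?ler0n ?ler0z//.
have n0' : 0 < n%:R :> R by rewrite ltr0n.
have m0' : 0 < `|m|%:~R :> R by rewrite ltr0z normr_gt0.
have x0' : 0 < `|x|%:~R :> R by rewrite ltr0z normr_gt0.
rewrite ler_pdivlMr ?powR_gt0 ?mulr_gt0// mulrC ler_pdivrMr ?powR_gt0//.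
rewrite -powRM ?ler0n ?(ltW x0')// ge0_ler_powR ?nnegrE ?mulr_ge0 ?(ltW x0', ltW m0')//.
by move: nmx; rewrite -(ler_int R) !intrM.
Qed.

(** Both the old entry and [m] are nonzero, so the support and with it the weight stay the same, and
    only the factor at [s] changes. *)
Lemma rinv_upd_le (R : realType) (a : R) (gamma : {fset nat} -> R) (d n : nat)
    (h : 'rV[int]_d) (s : 'I_d) (m : int) :
  1 < a -> (0 < n)%N -> (forall u, 0 <= gamma u) ->
  m != 0 -> n%:Z * `|m| <= 2 * `|h 0 s| ->
  rinv a gamma h <= 2 `^ a * (n%:R `^ a)^-1 * rinv a gamma (upd h s m).
Proof.
move=> a1 n0 g0 m0 nmh.
have hs0 : h 0 s != 0.
  apply: contraTneq nmh => ->; rewrite normr0 mulr0 -ltNge.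
  by rewrite mulr_gt0 ?normr_gt0// ltz_nat.
rewrite /rinv supp_upd// mem_fset1U ?in_supp//.
rewrite mulrCA ler_wpM2l// prod_wt_upd (bigD1 s)//= mulrA.
by rewrite ler_wpM2r ?wt_le// prodr_ge0// => j _; exact: wt_ge0.
Qed.

Section core.
Context {R : realType} {a : R} {gamma : {fset nat} -> R} {d : nat}
  {s : 'I_d} {F F1 : R}.
Hypotheses (a1 : 1 < a) (g0 : forall u, 0 <= gamma u) (F1_ge0 : 0 <= F1).
Local Notation f := (@rinv R a gamma d).
Hypothesis fF : (\esum_(h in [set: 'rV[int]_d]) (f h)%:E <= F%:E)%E.
Hypothesis fF1 : forall k,
  (\esum_(h in agree_nz s k) (f h)%:E <= F1%:E)%E.

Let f0 h : 0 <= f h. Proof. exact: rinv_ge0. Qed.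

(** The first vector is free and contributes [F]; once it is fixed, the second one ranges over
    [agree_nz] and contributes at most [F1]. *)
Lemma esum_pairs_snd :
  (\esum_(p in pairs_snd s) (f p.1 * f p.2)%:E
   <= (F * F1)%:E)%E.
Proof.
rewrite (_ : pairs_snd s =
  [set: 'rV[int]_d] `*`` agree_nz s); last first.
  by apply/seteqP; split => -[k h] /= => [|[]].
rewrite -(@esum_esum _ _ _ _ _ (fun k h => (f k * f h)%:E)); last first.
  by move=> k h _ _; rewrite lee_fin mulr_ge0.
apply: (@le_trans _ _ (\esum_(k in [set: 'rV[int]_d]) (F1%:E * (f k)%:E))%E).
  apply: le_esum => k _; under eq_esum do rewrite EFinM.
  rewrite esumZl// => [|h _]; last by rewrite lee_fin.
  by rewrite muleC lee_wpmul2r// lee_fin.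
rewrite esumZl// => [|h _]; last by rewrite lee_fin.
by rewrite mulrC EFinM lee_wpmul2l// lee_fin.
Qed.

Lemma esum_pairs_fst :
  (\esum_(p in pairs_fst s) (f p.1 * f p.2)%:E
   <= (F * F1)%:E)%E.
Proof.
apply: le_trans esum_pairs_snd.
under eq_esum do rewrite mulrC.
apply: (@le_esum_inj _ _ _ (fun p => (p.2, p.1)) _ _ (fun p => (f p.1 * f p.2)%:E)).
  by move=> [x y] [x' y'] _ _ [-> ->].
by move=> [x y] /= [xy x0]; split => // j sj; rewrite xy.
Qed.

(** Two different entries at [s] cannot both be zero, so the pairs are covered by two sets that are
    mirror images of each other. *)
Lemma esum_pairs_le :
  (\esum_(p in pairs s) (f p.1 * f p.2)%:E <= (2 * F * F1)%:E)%E.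
Proof.
apply: (@le_trans _ _ (\esum_(p in pairs_fst s `|`
    pairs_snd s) (f p.1 * f p.2)%:E)%E).
  apply: subset_esum => -[k h] /= [kh kh0]; have [k0|/eqP k0] := eqVneq (k 0 s) 0.
    by right; split => // h0; rewrite k0 h0 in kh0.
  by left.
apply: le_trans (esum_setU_le _ _ _) _ => [p|]; first by rewrite lee_fin mulr_ge0.
rewrite -mulrA (mulrDl 1 1) mul1r EFinD leeD//; first exact: esum_pairs_fst.
exact: esum_pairs_snd.
Qed.

Lemma esum_pairs_dvd_le (n : nat) : (0 < n)%N ->
  (\esum_(p in pairs_dvd n s)
     (f p.1 * f p.2)%:E <= (2 `^ (a + 1) * (n%:R `^ a)^-1 * F * F1)%:E)%E.
Proof.
move=> n0; set D := pairs_dvd n s.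
pose m (p : 'rV[int]_d * 'rV[int]_d) := ((p.2 0 s - p.1 0 s)%R %/ n%:Z)%Z.
have n0z : n%:Z != 0 by rewrite eqz_nat -lt0n.
have mE p : D p -> p.2 0 s - p.1 0 s = n%:Z * m p.
  by move=> [_ /= /divzK e]; rewrite mulrC.
have m0 p : D p -> m p <> 0.
  move=> Dp; have := mE p Dp; case: Dp => [[_ +] _] + e; rewrite e mulr0.
  by move=> + /eqP; rewrite subr_eq0 => pp /eqP/esym.
have C0 : 0 <= 2 `^ a * (n%:R `^ a)^-1 :> R by rewrite mulr_ge0 ?invr_ge0 ?powR_ge0.
(* One of the two entries at s is at least n |m| / 2 in absolute value. *)
apply: (@le_trans _ _ (\esum_(p in D) ((2 `^ a * (n%:R `^ a)^-1)%:E *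
   ((f p.1 * f (upd p.2 s (m p)))%:E + (f (upd p.1 s (m p)) * f p.2)%:E)))%E).
  apply: le_esum => p Dp; rewrite -EFinD -EFinM lee_fin mulrDr.
  have /eqP mp0 := m0 p Dp.
  have nm : n%:Z * `|m p| <= `|p.2 0 s| + `|p.1 0 s|.
    by rewrite -[n%:Z]/`|n%:Z| -normrM -mE// ler_normB.
  have [le12|le21] := leP `|p.1 0 s| `|p.2 0 s|.
    rewrite ler_wpDr//; first by apply: mulr_ge0 => //; apply: mulr_ge0.
    rewrite [leRHS]mulrCA ler_wpM2l//; apply: rinv_upd_le => //.
    by rewrite (le_trans nm)// mulr2n mulrDl mul1r lerD2l.
  rewrite ler_wpDl//; first by apply: mulr_ge0 => //; apply: mulr_ge0.
  rewrite [leRHS]mulrA ler_wpM2r//; apply: rinv_upd_le => //.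
  by rewrite (le_trans nm)// mulr2n mulrDl mul1r lerD2r ltW.
rewrite esumZl//; last by move=> p _; rewrite adde_ge0// lee_fin mulr_ge0.
rewrite esumD => [|p _|p _]; [|by rewrite lee_fin mulr_ge0..].
rewrite (_ : 2 `^ (a + 1) * _ * F * F1 =
    2 `^ a * (n%:R `^ a)^-1 * (F * F1 + F * F1)); last first.
  rewrite powRD ?pnatr_eq0 ?implybT// powRr1//; ring.
rewrite [leRHS]EFinM lee_wpmul2l ?lee_fin// EFinD leeD//.
(* The replacement is injective: the untouched vector gives one entry at [s], and adding or
   subtracting n m recovers the replaced one. *)
- apply: le_trans esum_pairs_snd.
  apply: (@le_esum_inj _ _ _ (fun p => (p.1, upd p.2 s (m p))) _ _
    (fun p => (f p.1 * f p.2)%:E)).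
    move=> [k h] [k' h'] Dp Dq /= [kk' e]; congr (_, _) => //.
    apply/rowP => j; have := congr1 (fun g : 'rV[int]_d => g 0 j) e.
    rewrite /= !mxE; case: eqP => [->|//] mm.
    by have := mE _ Dp; rewrite mm -mE//= kk' => /addIr.
  move=> [k h] Dp; split => /=; last by rewrite upd_eq; exact: m0.
  by case: (Dp) => -[/= kh _] _ j sj; rewrite upd_ne ?kh// gt_eqF.
- apply: le_trans esum_pairs_fst.
  apply: (@le_esum_inj _ _ _ (fun p => (upd p.1 s (m p), p.2)) _ _
    (fun p => (f p.1 * f p.2)%:E)).
    move=> [k h] [k' h'] Dp Dq /= [e hh']; congr (_, _) => //.
    apply/rowP => j; have := congr1 (fun g : 'rV[int]_d => g 0 j) e.
    rewrite /= !mxE; case: eqP => [->|//] mm.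
    by have := mE _ Dp; rewrite mm -mE//= hh' => /addrI/oppr_inj.
  move=> [k h] Dp; split => /=; last by rewrite upd_eq; exact: m0.
  by case: (Dp) => -[/= kh _] _ j sj; rewrite upd_ne ?kh// gt_eqF.
Qed.

End core.

(** * Averaging over one component of the generating vector *)

Lemma dotz_upd (d : nat) (l z : 'rV[int]_d) (s : 'I_d) (c : int) :
  dotz l (upd z s c) = dotz l (upd z s 0) + l 0 s * c.
Proof.
rewrite /dotz (bigD1 s)//= [in RHS](bigD1 s)//= !upd_eq mulr0 add0r addrC.
by congr (_ + _); apply: eq_bigr => j js; rewrite !upd_ne.
Qed.

Lemma modz0P (n : nat) (x : int) :
  reflect (x = 0 %[mod n%:Z])%Z (n%:Z %| x)%Z.
Proof. by apply: (iffP dvdz_mod0P); rewrite mod0z. Qed.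

(** Subtracting the two conditions gives n | l_s (b - c). As n is prime and does not divide l_s, it
    divides b - c, and both numbers are below n. *)
Lemma dual_unique (d n : nat) (l z : 'rV[int]_d) (s : 'I_d) (b c : nat) :
  prime n -> ~~ (n%:Z %| (l 0 s)%R)%Z -> (b < n)%N -> (c < n)%N ->
  (n%:Z %| dotz l (upd z s b%:Z))%Z -> (n%:Z %| dotz l (upd z s c%:Z))%Z -> b = c.
Proof.
move=> pn nl bn cn; rewrite (dotz_upd _ _ _ b) (dotz_upd _ _ _ c) => nb nc.
have : (n%:Z %| (l 0 s * (b%:Z - c%:Z))%R)%Z.
  rewrite (_ : _ * _ = (dotz l (upd z s 0) + l 0 s * b%:Z) -
    (dotz l (upd z s 0) + l 0 s * c%:Z)); last by ring.
  exact: rpredB.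
rewrite dvdzE abszM Euclid_dvdM// -!dvdzE (negPf nl)/= => nbc.
have : (n%:Z %| (b%:Z - c%:Z)%R)%Z by [].
by rewrite -eqz_mod_dvd => /eqP; rewrite !modz_nat !modn_small// => -[->].
Qed.

(** The contrapositive says that the minimum is at most the average, which is how [cbc_average] uses
    it. *)
Lemma sume_lt (R : realType) (I : eqType) (r : seq I) (B : R) (T : I -> \bar R) :
  r != [::] -> (forall i, i \in r -> B%:E < T i)%E ->
  (((size r)%:R * B)%:E < \sum_(i <- r) T i)%E.
Proof.
case: r => // i r _; elim: r i => [|j r IH] i BT.
  by rewrite big_seq1 mul1r BT// mem_head.
rewrite big_cons -[size _]/(size (j :: r)).+1 -natr1 mulrDl mul1r addrC EFinD.
rewrite lteD// ?BT ?mem_head//; apply: IH => k kr; apply: BT.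
by rewrite in_cons kr orbT.
Qed.

Section average.
Context {R : realType} {a : R} {gamma : {fset nat} -> R} {d n : nat}
  {z : 'rV[int]_d} {s : 'I_d} {F F1 : R}.
Hypotheses (a1 : 1 < a) (g0 : forall u, 0 <= gamma u) (F1_ge0 : 0 <= F1)
  (pn : prime n).
Local Notation f := (@rinv R a gamma d).
Hypothesis fF : (\esum_(h in [set: 'rV[int]_d]) (f h)%:E <= F%:E)%E.
Hypothesis fF1 : forall k, (\esum_(h in agree_nz s k) (f h)%:E <= F1%:E)%E.

(** After exchanging the sums, a pair is multiplied by the number of c that admit it. This is at
    most one by [dual_unique] if n does not divide the difference at [s], and trivially at most n -
    1 otherwise. *)
Lemma sum_dual_pairs_le :
  (\sum_(c <- index_iota 1 n)
     \esum_(p in dual_pairs n z s c%:Z) (f p.1 * f p.2)%:E <=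
   \esum_(p in pairs s) (f p.1 * f p.2)%:E +
   n.-1%:R%:E * \esum_(p in pairs_dvd n s) (f p.1 * f p.2)%:E)%E.
Proof.
have ff0 p : 0 <= f p.1 * f p.2 by rewrite mulr_ge0// rinv_ge0.
have dual_mk c : dual_pairs n z s c = pairs s `&` [set p |
    (dotz (p.2 - p.1) (upd z s c) = 0 %[mod n%:Z])%Z] by [].
under eq_bigr do rewrite dual_mk esum_mkcondr.
rewrite -esum_sum => [|p c _ _]; last by case: ifP; rewrite // lee_fin.
have -> : pairs_dvd n s = pairs s `&`
    [set p : 'rV[int]_d * 'rV[int]_d | (n%:Z %| (p.2 0 s - p.1 0 s)%R)%Z] by [].
rewrite [X in (_ * X)%E]esum_mkcondr -esumZl//; last by move=> p _; case: ifP; rewrite // lee_fin.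
rewrite -esumD => [|p _|p _]; last 2 first.
- by rewrite lee_fin.
- by rewrite mule_ge0//; case: ifP; rewrite // lee_fin.
apply: le_esum => p _; rewrite -big_mkcond/= sumEFin.
rewrite big_const_seq iter_addr_0.
set P := (X in count X _).
case: ifPn => [_|]; rewrite ?mule0 ?adde0.
  rewrite -EFinM -EFinD lee_fin -[leLHS]mulr_natl ler_wpDl// ler_wpM2r// ler_nat.
  by rewrite (leq_trans (count_size _ _))// size_iota subn1.
rewrite notin_setE/= => nl; rewrite lee_fin -[leRHS]mulr1n ler_wpMn2l//.
(* Two admissible values b and c at the head of the filtered list would be equal, although the list
   has no repetition. *)
rewrite -size_filter; case fr : [seq x <- index_iota 1 n | P x] => [|b [|c r]]//=.
have : uniq [seq x <- index_iota 1 n | P x] by rewrite filter_uniq// iota_uniq.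
have inP x : x \in [:: b, c & r] -> P x /\ (x < n)%N.
  by rewrite -fr mem_filter mem_index_iota => /and3P[].
have [Pb bn] := inP b (mem_head _ _).
have [Pc cn] : P c /\ (c < n)%N by apply: inP; rewrite !inE eqxx orbT.
move: Pb Pc; rewrite /P !inE => /modz0P Pb /modz0P Pc.
rewrite fr/= inE (@dual_unique _ n (p.2 - p.1) z s b c)//; first by rewrite eqxx.
by apply/negP; rewrite !mxE.
Qed.

(** If all n - 1 values of c exceeded the bound, their sum would exceed n - 1 times the bound,
    against [sum_dual_pairs_le] and the two estimates for pairs. *)
Lemma cbc_average (t : R) : 5 / 2 + 2 `^ (2 * a + 1) <= t ->
  exists2 c : int, 1 <= c < n%:Z &
    (\esum_(p in dual_pairs n z s c) (f p.1 * f p.2)%:E <= (t / n%:R * F * F1)%:E)%E.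
Proof.
move=> ht; have n1 : (1 < n)%N := prime_gt1 pn.
have F0 : 0 <= F.
  by rewrite -lee_fin; apply: le_trans fF; apply: esum_ge0 => h _; rewrite lee_fin rinv_ge0.
apply: contrapT => /forall2NP H.
have := @sume_lt _ _ (index_iota 1 n) (t / n%:R * F * F1)
  (fun c => \esum_(p in dual_pairs n z s c%:Z) (f p.1 * f p.2)%:E)%E.
have -> : index_iota 1 n != [::] by rewrite -size_eq0 size_iota subn_eq0 -ltnNge.
move=> /(_ isT) H1; suff /H1 : (forall i, i \in index_iota 1 n ->
   ((t / n%:R * F * F1)%:E < \esum_(p in dual_pairs n z s i%:Z) (f p.1 * f p.2)%:E)%E).
  apply/negP; rewrite -leNgt size_iota subn1; apply: (le_trans sum_dual_pairs_le).
  apply: (le_trans (leeD (esum_pairs_le g0 F1_ge0 fF fF1)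
    (lee_wpmul2l _ (esum_pairs_dvd_le a1 g0 F1_ge0 fF fF1 (ltnW n1))))).
    by rewrite lee_fin.
  rewrite -EFinM -EFinD lee_fin.
  have N0 : (1 : R) <= n.-1%:R by rewrite ler1n -ltnS prednK// ltnW.
  have nE : n%:R = n.-1%:R + 1 :> R by rewrite natr1 prednK// ltnW.
  set N := n.-1%:R in N0 nE *.
  have -> : 2 * F * F1 + N * (2 `^ (a + 1) / n%:R `^ a * F * F1) =
     (2 + N * (2 `^ (a + 1) / n%:R `^ a)) * (F * F1) by ring.
  have -> : N * (t / n%:R * F * F1) = (N * t / n%:R) * (F * F1).
    by rewrite !mulrA.
  rewrite ler_wpM2r ?mulr_ge0//.
  have n0 : 0 < n%:R :> R by rewrite ltr0n ltnW.
  have x2 : 2 <= 2 `^ a :> R by rewrite -[leLHS]powRr1// ler_powR// ?ler1n// ltW.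
  have e1 : 2 `^ (a + 1) = 2 * 2 `^ a :> R.
    by rewrite powRD ?pnatr_eq0 ?implybT// powRr1// mulrC.
  have e2 : 2 `^ (2 * a + 1) = 2 * (2 `^ a) ^+ 2 :> R.
    rewrite (_ : 2 * a = a + a); last by ring.
    by rewrite !powRD ?pnatr_eq0 ?implybT// powRr1// mulrC expr2.
  have na : (n%:R `^ a)^-1 <= n%:R^-1 :> R.
    by rewrite lef_pV2 ?posrE ?powR_gt0// -[leLHS]powRr1 ?ler0n// ler_powR// ?ler1n ?(ltnW n1) ?(ltW a1).
  apply: (@le_trans _ _ (2 + N * (2 `^ (a + 1) * n%:R^-1))).
    by rewrite lerD2l ler_wpM2l ?(le_trans _ N0)// ler_wpM2l ?powR_ge0.
  rewrite ler_pdivlMr// mulrDl -!mulrA mulVf ?gt_eqF// mulr1.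
  rewrite nE e1; move: ht; rewrite e2; set x := 2 `^ a in x2 * => ht'.
  (* With N = n - 1 the goal is 2 (N + 1) + 2 x N <= N t. As N >= 1, it suffices that t >= 4 + 2 x,
     while the hypothesis gives t >= 5/2 + 2 x^2 >= 5/2 + 2 (x + 2). *)
  have xx : x + 2 <= x ^+ 2 by nra.
  nra.
move=> c; rewrite mem_index_iota => /andP[c1 cn].
by have [|/negP] := H c%:Z; [rewrite lez_nat ltz_nat c1 cn|rewrite -ltNge].
Qed.

End average.

(** * Decomposition of the error criterion *)

Lemma rinvE (R : realType) (a : R) (gamma : {fset nat} -> R) (d : nat)
    (h : 'rV[int]_d) : (r a gamma h)^-1 = rinv a gamma h.
Proof. by rewrite /r invf_div /rinv -r'V. Qed.

Section splice.
Context {d : nat} {s : 'I_d}.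

Definition splice (g : 'rV[int]_s.+1) (h : 'rV[int]_d) : 'rV[int]_d :=
  \row_j (if (j < s.+1)%N then g 0 (inord j) else h 0 j).

Definition head_part (h : 'rV[int]_d) : 'rV[int]_s.+1 :=
  \row_j h 0 (widen_ord (ltn_ord s) j).

(** Kept in dimension [d] with leading zeros, so that the coordinates keep their numbers and the
    support is one of the sets w summed over in [T_cbc]. *)
Definition tail_part (h : 'rV[int]_d) : 'rV[int]_d :=
  \row_j (if (j < s.+1)%N then 0 else h 0 j).

Lemma splice_widen g h j : splice g h 0 (widen_ord (ltn_ord s) j) = g 0 j.
Proof. by rewrite mxE /= ltn_ord inord_val. Qed.

Lemma splice_ord g h : splice g h 0 s = g 0 ord_max.
Proof. by rewrite -(splice_widen g h); congr (splice _ _ 0 _); apply/val_inj. Qed.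

Lemma splice_tail g h (j : 'I_d) : (s < j)%N -> splice g h 0 j = h 0 j.
Proof. by move=> sj; rewrite mxE ltnS leqNgt sj. Qed.

Lemma splice_head (g : 'rV[int]_s.+1) (h : 'rV[int]_d) : head_part (splice g h) = g.
Proof. by apply/rowP => j; rewrite mxE splice_widen. Qed.

Lemma head_tailK h : splice (head_part h) (tail_part h) = h.
Proof.
apply/rowP => j; rewrite !mxE; case: ifP => [js|->//].
by congr (h _ _); apply/val_inj; rewrite /= inordK.
Qed.

Lemma tail_partE (h : 'rV[int]_d) : (supp h `<=` irange s.+1 d)%fset ->
  forall j : 'I_d, (j < s.+1)%N -> h 0 j = 0.
Proof.
move=> /fsubsetP hs j js; apply/eqP; apply: contraLR js; rewrite -in_supp => /hs.
by rewrite mem_irange -leqNgt => /andP[].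
Qed.

Lemma supp_tail_part h : (supp (tail_part h) `<=` irange s.+1 d)%fset.
Proof.
apply/fsubsetP => _ /suppP[j + ->]; rewrite mxE mem_irange ltn_ord andbT.
by case: ifP; rewrite ?eqxx// ltnS => /negbT; rewrite -ltnNge.
Qed.

Lemma supp_splice g h : (supp h `<=` irange s.+1 d)%fset ->
  supp (splice g h) = (supp g `|` supp h)%fset.
Proof.
move=> hs; apply/fsetP => i; rewrite in_fsetU; apply/suppP/orP.
  move=> [j + ->]; rewrite mxE; case: ifP => [js gj|_ hj]; [left|right].
    by apply/suppP; exists (inord j); rewrite ?inordK.
  by apply/suppP; exists j.
move=> [/suppP[j gj ->]|/suppP[j hj ->]].
  by exists (widen_ord (ltn_ord s) j); rewrite ?splice_widen.
exists j => //; rewrite mxE; case: ifP => // /(tail_partE hs) hj0.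
by rewrite hj0 eqxx in hj.
Qed.

Lemma prod_wt_splice (R : realType) (a : R) g h : (supp h `<=` irange s.+1 d)%fset ->
  \prod_j wt a (splice g h 0 j) = (\prod_j wt a (g 0 j)) * \prod_j wt a (h 0 j).
Proof.
move=> hs; rewrite (bigID (fun j : 'I_d => (j < s.+1)%N))/=.
rewrite [X in _ = _ * X](bigID (fun j : 'I_d => (j < s.+1)%N))/=.
rewrite [X in _ = _ * (X * _)]big1 ?mul1r => [|j /(tail_partE hs) ->]; last exact: wt0.
congr (_ * _); last first.
  by apply: eq_bigr => j; rewrite mxE => /negPf ->.
rewrite (big_ord_narrow (ltn_ord s)); apply: eq_bigr => j _.
by rewrite splice_widen.
Qed.

(** The common tail cancels in the difference, so only the prefix of the generating vector
    matters. *)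
Lemma dotz_splice (g k : 'rV[int]_s.+1) (h z : 'rV[int]_d) c :
  dotz (splice k h - splice g h) (upd z s c) = dotz (k - g) (cbc_prefix z s c).
Proof.
rewrite /dotz (bigID (fun j : 'I_d => (j < s.+1)%N))/= [X in _ + X]big1; last first.
  by move=> j /negPf js; rewrite !mxE js subrr mul0r.
rewrite addr0 (big_ord_narrow (ltn_ord s)); apply: eq_bigr => j _.
by rewrite mxE [X in _ + X]mxE !splice_widen !mxE; congr (_ * _).
Qed.

End splice.

Lemma T_cbcE (R : realType) (a : R) (gamma : {fset nat} -> R) (n d : nat)
    (z : 'rV[int]_d) (s : 'I_d) (c : int) :
  1 < a -> (forall u, 0 <= gamma u) ->
  (T_cbc a gamma n d (cbc_prefix z s c) =
   \esum_(p in dual_pairs n z s c) (rinv a gamma p.1 * rinv a gamma p.2)%:E)%E.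
Proof.
move=> a1 g0.
have zz0 : 0 <= 2 * zeta (2 * a).
  by rewrite (le_trans ler01)// zeta2_ge1//; lra.
(* The entries h of the vectors after s are shared by both factors of a pair and
   so get the exponent 2 a; summing over them with support w gives the factor
   [2 zeta(2 a)]^|w| of T_cbc. *)
pose X (w : {fset nat}) (q : 'rV[int]_s.+1 * 'rV[int]_s.+1) : R :=
  (gamma (supp q.1 `|` w)%fset * \prod_j wt a (q.1 0 j)) *
  (gamma (supp (q.1 + q.2) `|` w)%fset * \prod_j wt a ((q.1 + q.2) 0 j)).
have X0 w q : 0 <= X w q by rewrite !mulr_ge0// prod_wt_ge0.
pose L : set ('rV[int]_s.+1) := [set l : 'rV[int]_s.+1 | l 0 ord_max <> 0 /\
  (dotz l (cbc_prefix z s c) = 0 %[mod n%:Z])%Z].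
have thetaE w : theta a n (cbc_prefix z s c) (fun u => gamma (u `|` w)%fset) =
    (\esum_(q in [set: 'rV[int]_s.+1] `*`` (fun=> L)) (X w q)%:E)%E.
  rewrite -(@esum_esum _ _ _ _ _ (fun h l => (X w (h, l))%:E)); last first.
    by move=> h l _ _; rewrite lee_fin.
  apply: eq_esum => h _; apply: eq_esum => l _.
  by rewrite !r'V.
transitivity (\esum_(q in [set: 'rV[int]_s.+1] `*`` (fun=> L))
    \esum_(h in [set h : 'rV[int]_d | (supp h `<=` irange s.+1 d)%fset])
      (X (supp h) q * \prod_j wt (2 * a) (h 0 j))%:E)%E.
  transitivity (\esum_(q in [set: 'rV[int]_s.+1] `*`` (fun=> L))
     (\sum_(w <- fpowerset (irange s.+1 d)) (X w q * (2 * zeta (2 * a)) ^+ #|` w|)%:E))%E.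
    rewrite esum_sum => [|q w _ _]; last by rewrite lee_fin mulr_ge0 ?exprn_ge0.
    apply: eq_bigr => w _; rewrite thetaE -esumZl ?exprn_ge0// => [|q _].
      by apply: eq_esum => q _; rewrite -EFinM mulrC.
    by rewrite lee_fin.
  apply: eq_esum => q _; rewrite sumEFin (@esum_supp _ _ _ _ (fun w => X w q))//.
    lra.
  by apply/fsubsetP => i; rewrite !mem_irange => /andP[si ->]; rewrite (leq_ltn_trans _ si).
rewrite esum_esum => [|q h _ _]; last by rewrite lee_fin mulr_ge0// prod_wt_ge0.
(* A pair in [dual_pairs] is cut after [s] into two heads g and g + l and one common tail h;
   conversely such a triple determines the pair. *)
rewrite (@reindex_esum _ _ _
  (([set: 'rV[int]_s.+1] `*`` (fun=> L)) `*``
   (fun=> [set h : 'rV[int]_d | (supp h `<=` irange s.+1 d)%fset])) _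
  (fun p => (splice p.1.1 p.2, splice (p.1.1 + p.1.2) p.2))).
  apply: eq_esum => -[[g l] h] /= [_ hs].
  rewrite /rinv !supp_splice// !prod_wt_splice// /X/= (_ : \prod_j wt (2 * a) _ =
    \prod_j wt a (h 0 j) * \prod_j wt a (h 0 j)); last first.
    rewrite -big_split/=; apply: eq_bigr => j _; rewrite /wt; case: ifP => _.
      by rewrite mulr1.
    have h0 : 0 <= `|h 0 j|%:~R :> R by rewrite ler0z.
    rewrite -invfM -powRM// -expr2; congr (_^-1).
    by rewrite powRrM powR_mulrn.
  by congr EFin; ring.
split.
- move=> [[g l] h] /= [[_ [l0 dl]] hs]; split => /=.
    split => [j sj|]; first by rewrite !splice_tail.
    rewrite !splice_ord [in RHS]mxE => /eqP; rewrite -subr_eq0 opprD addNKr.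
    by rewrite oppr_eq0 => /eqP.
  by rewrite dotz_splice addrC addKr.
- move=> [[g l] h] [[g' l'] h']; rewrite !inE => -[/= _ hs] [/= _ hs'] [e1 e2].
  have gg : g = g' by rewrite -(splice_head g h) e1 splice_head.
  have ll : g + l = g' + l' by rewrite -(splice_head (g + l) h) e2 splice_head.
  move: ll; rewrite gg => /addrI ->; congr (_, _); apply/rowP => j.
  have [js|js] := ltnP j s.+1; first by rewrite (tail_partE hs) ?(tail_partE hs').
  by rewrite -(splice_tail g h)// e1 splice_tail.
- move=> [h k] [[/= hk hks] dhk].
  have tE : @tail_part d s h = @tail_part d s k.
    by apply/rowP => j; rewrite !mxE; case: ltnP => // sj; rewrite hk.
  exists (@head_part d s h, @head_part d s k - head_part h, @tail_part d s h); last first.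
    by rewrite /= addrC subrK head_tailK tE head_tailK.
  split; last exact: supp_tail_part.
  split => //; split => /=.
    rewrite !mxE (_ : widen_ord _ _ = s); last exact/val_inj.
    by move=> /eqP; rewrite subr_eq0 => /eqP /esym.
  by rewrite -(@dotz_splice _ _ _ _ (@tail_part d s h)) head_tailK tE head_tailK.
Qed.

(** The nonzero dual vectors are covered by the sets [E s], which fix the position of the last
    nonzero entry, and then (h, l) is sent injectively to (h, h + l). *)
Lemma S_err_le (R : realType) (a : R) (gamma : {fset nat} -> R) (n d : nat)
    (z : 'rV[int]_d) : (forall u, 0 <= gamma u) ->
  (S_err a gamma n z <= \sum_(s : 'I_d)
   \esum_(p in dual_pairs n z s (z 0%R s)) (rinv a gamma p.1 * rinv a gamma p.2)%:E)%E.
Proof.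
move=> g0; pose L := [set l : 'rV[int]_d | l <> 0 /\ (dotz l z = 0 %[mod n%:Z])%Z].
have -> : S_err a gamma n z = (\esum_(q in [set: 'rV[int]_d] `*`` (fun=> L))
    (rinv a gamma q.1 * rinv a gamma (q.1 + q.2)%R)%:E)%E.
  rewrite -(@esum_esum _ _ _ _ _ (fun h l => (rinv a gamma h * rinv a gamma (h + l)%R)%:E)); last first.
    by move=> h l _ _; rewrite lee_fin mulr_ge0// rinv_ge0.
  apply: eq_esum => h _; rewrite rinvE -esumZl ?rinv_ge0//.
    by apply: eq_esum => l _; rewrite rinvE.
  by move=> l _; rewrite rinvE lee_fin rinv_ge0.
pose E s := [set q : 'rV[int]_d * 'rV[int]_d |
  q.2 0 s <> 0 /\ forall j : 'I_d, (s < j)%N -> q.2 0 j = 0].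
apply: (le_trans (@esum_cover_le _ _ _ _ E _ _ _)).
- by move=> q; rewrite lee_fin mulr_ge0// rinv_ge0.
- move=> [h l] [_ [l0 _]].
  have [j lj] : exists j, l 0 j != 0.
    apply: contrapT => /forallNP H; apply: l0; apply/rowP => j; rewrite mxE.
    by apply/eqP; move/negP: (H j); rewrite negbK.
  (* The largest index with a nonzero entry; the witness [j] only shows that there is one. *)
  exists [arg max_(i > j | l 0 i != 0) (i : nat)]; case: arg_maxnP => // i li imax.
  split => /= [|k ik]; first exact/eqP.
  by apply/eqP; apply: contraLR ik => /imax; rewrite -leqNgt.
rewrite lee_sum// => s _.
apply: (@le_esum_inj _ _ _ (fun q => (q.1, (q.1 + q.2)%R)) _ _
   (fun p => (rinv a gamma p.1 * rinv a gamma p.2)%:E)).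
  by move=> [h l] [h' l'] _ _ [-> /addrI ->].
move=> [h l] [[_ [_ /= dl]] [/= ls lt]]; split; last first.
  by rewrite upd_id /= addrC addKr.
split => /= [j sj|]; first by rewrite mxE lt// addr0.
by rewrite mxE => /eqP; rewrite -subr_eq0 opprD addNKr oppr_eq0 => /eqP.
Qed.

(** * The error bounds *)

Lemma wt_powR (R : realType) (a lam : R) (x : int) : wt a x `^ lam = wt (a * lam) x.
Proof.
rewrite /wt; case: ifP => _; first by rewrite powR1.
by rewrite -!powRN -powRrM mulNr.
Qed.

Lemma rinv_powR (R : realType) (a lam : R) (gamma : {fset nat} -> R) (d : nat)
    (h : 'rV[int]_d) : (forall u, 0 <= gamma u) ->
  rinv a gamma h `^ lam = rinv (a * lam) (fun u => gamma u `^ lam) h.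
Proof.
move=> g0; rewrite /rinv powRM ?prod_wt_ge0//; congr (_ * _).
(* Nonnegativity of the partial products is carried through the induction because [powRM] asks for
   it. *)
suff [] : 0 <= \prod_j wt a (h 0 j) /\
    (\prod_j wt a (h 0 j)) `^ lam = \prod_j wt (a * lam) (h 0 j) by [].
apply: (big_rec2 (fun x y => 0 <= x /\ x `^ lam = y)) => [|j y x _ [x0 <-]].
  by rewrite powR1.
by rewrite mulr_ge0 ?wt_ge0// powRM ?wt_ge0// wt_powR.
Qed.

Lemma wt_le1 (R : realType) (a : R) (x : int) : 0 <= a -> wt a x <= 1.
Proof.
move=> a0; rewrite /wt; case: eqVneq => // x0; rewrite invf_le1 ?powR_gt0 ?ltr0z ?normr_gt0//.
by rewrite -[leLHS](@powRr0 _ (`|x|%:~R)) ler_powR// ler1z -gtz0_ge1 normr_gt0.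
Qed.

(** Will be used with [P] expressing that s + 1 is the largest element of a given set. *)
Lemma sum_unique_le (R : numDomainType) (I : finType) (P : pred I) (x : R) :
  0 <= x -> (forall i j, P i -> P j -> i = j) ->
  \sum_(i | P i) x <= (if [exists i, P i] then x else 0).
Proof.
move=> x0 uP; case: existsP => [[i Pi]|nP].
  rewrite (bigD1 i)//= big1 ?addr0// => j /andP[Pj /eqP]; case.
  exact: uP.
by rewrite big1// => i Pi; case: nP; exists i.
Qed.

Section cbc_bound.
Context {R : realType} {alpha lam : R} {gamma : {fset nat} -> R} {n d : nat}
  {z : 'rV[int]_d}.
Hypotheses (alpha1 : 1 < alpha) (lam_gt : alpha^-1 < lam) (lam1 : lam <= 1)
  (pn : prime n) (g0 : forall u, 0 <= gamma u) (hz : is_cbc alpha gamma n z).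
Let G u := gamma u `^ lam.
Let F := \sum_(u <- fpowerset (irange 0 d)) G u * (2 * zeta (alpha * lam)) ^+ #|` u|.

Let alpha_gt0 : 0 < alpha. Proof. exact: lt_trans alpha1. Qed.

Let lam_gt0 : 0 < lam. Proof. by rewrite (lt_trans _ lam_gt)// invr_gt0. Qed.

Let b1 : 1 < alpha * lam. Proof. by rewrite -ltr_pdivrMl// mulr1. Qed.

Let G0 u : 0 <= G u. Proof. exact: powR_ge0. Qed.

Let Z0 k : 0 <= (2 * zeta (alpha * lam)) ^+ k.
Proof. by rewrite exprn_ge0// (le_trans ler01)// zeta2_ge1. Qed.

Lemma esum_rinvT :
  (\esum_(h in [set: 'rV[int]_d]) (rinv (alpha * lam) G h)%:E = F%:E)%E.
Proof.
rewrite -(@esum_supp _ _ d)//; congr esum.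
by apply/esym/seteqP; split => // h _; exact: supp_irange.
Qed.

(** Averaging at exponent [alpha * lam] provides some c, not necessarily z_s. By subadditivity
    T_{d,s} at this c is at most the root of [B s], and by minimality so is T_{d,s} at z_s. *)
Lemma S_err_bound (F1 : 'I_d -> R) (F1tot : R) :
  (forall s, 0 <= F1 s) ->
  (forall s k, (\esum_(h in agree_nz s k) (rinv (alpha * lam) G h)%:E <= (F1 s)%:E)%E) ->
  \sum_s F1 s <= F1tot ->
  (S_err alpha gamma n z <= ((tau alpha lam / n%:R * F1tot * F) `^ lam^-1)%:E)%E.
Proof.
move=> F10 fF1 F1tot_ge; pose B s := tau alpha lam / n%:R * F * F1 s.
have F0 : 0 <= F by apply: sumr_ge0 => u _; rewrite mulr_ge0.
have t0 : 0 <= tau alpha lam / n%:R.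
  by rewrite divr_ge0// /tau le_max ler0n.
have B0 s : 0 <= B s by apply: mulr_ge0 => //; exact: mulr_ge0.
have Tle s : (\esum_(p in dual_pairs n z s (z 0%R s))
    (rinv alpha gamma p.1 * rinv alpha gamma p.2)%:E <= (B s `^ lam^-1)%:E)%E.
  have [c c1n cB] := @cbc_average _ _ G _ _ z s F (F1 s) b1 G0 (F10 s) pn
    (eq_ind_r (fun x => (x <= F%:E)%E) (lexx _) esum_rinvT) (fF1 s) (tau alpha lam)
    (ltac: (by rewrite /tau le_max mulrA lexx orbT)).
  have [_ /(_ c c1n)] := hz s; rewrite !T_cbcE// => /le_trans; apply.
  apply: esum_powR_le; first by rewrite lam_gt0.
    by move=> p; rewrite mulr_ge0// rinv_ge0.
  apply: le_trans cB; apply: le_esum => p _.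
  by rewrite powRM ?rinv_ge0// !rinv_powR.
apply: (le_trans (S_err_le _ _ _ g0)).
apply: (@le_trans _ _ (\sum_(s < d) (B s `^ lam^-1)%:E)%E).
  by rewrite lee_sum.
rewrite sumEFin lee_fin -[leLHS](@powRVK _ lam) ?gt_eqF//; last first.
  by rewrite sumr_ge0// => s _; exact: powR_ge0.
rewrite ge0_ler_powR ?invr_ge0 ?(ltW lam_gt0) ?nnegrE ?powR_ge0//.
  by apply: mulr_ge0 => //; apply: mulr_ge0; rewrite // (le_trans _ F1tot_ge)// sumr_ge0.
(* Subadditivity a second time, now for the sum over the components s. *)
apply: le_trans (le_powR_sum _ _ _) _ => [|s|]; [by rewrite lam_gt0|exact: powR_ge0|].
under eq_bigr do rewrite powRKV ?gt_eqF//.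
by rewrite -mulr_sumr mulrAC ler_wpM2r// ler_wpM2l.
Qed.

(** Here F_s sums over all vectors with a nonzero entry at s, so it collects the sets u containing s
    + 1. In the sum over s each u occurs at most |u| times, whence the factor |u|. *)
Lemma S_err_bound1 : (S_err alpha gamma n z <=
  ((tau alpha lam / n%:R *
    (\sum_(u <- fpowerset (irange 0 d) | u != fset0)
       #|` u|%:R * G u * (2 * zeta (alpha * lam)) ^+ #|` u|) * F) `^ lam^-1)%:E)%E.
Proof.
pose phi (s : 'I_d) u := if s.+1 \in u then G u else 0.
have phi0 s u : 0 <= phi s u by rewrite /phi; case: ifP.
apply: (@S_err_bound (fun s => \sum_(u <- fpowerset (irange 0 d))
  phi s u * (2 * zeta (alpha * lam)) ^+ #|` u|)).
- by move=> s; apply: sumr_ge0 => u _; rewrite mulr_ge0.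
- move=> s k; rewrite -(@esum_supp _ _ d)//.
  apply: (@le_trans _ _ (\esum_(h in agree_nz s k)
      (phi s (supp h) * \prod_j wt (alpha * lam) (h 0 j))%:E)%E).
    apply: le_esum => h [_ hs]; rewrite lee_fin /phi in_supp.
    by move/eqP: hs => ->.
  by apply: subset_esum => h _; exact: supp_irange.
- rewrite exchange_big/= [leRHS]big_mkcond/= ler_sum// => u _.
  rewrite -mulr_suml -big_mkcond/= sumr_const -[G u *+ _]mulr_natl.
  have card_le : (#|[pred s : 'I_d | s.+1 \in u]| <= #|` u|)%N.
    rewrite cardE -(size_map (fun s : 'I_d => s.+1)) uniq_leq_size//.
      by rewrite map_inj_uniq ?enum_uniq// => i j [/val_inj].
    by move=> _ /mapP[i + ->]; rewrite mem_enum inE.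
  have [->|u0] := eqVneq u fset0.
    by rewrite (eq_card0 (A := [pred s : 'I_d | s.+1 \in fset0])) ?mul0r.
  by rewrite ler_wpM2r// ler_wpM2r// ler_nat.
Qed.

(** Here F_s sums over the heads only, so it collects the sets u with largest element s + 1. Each
    nonempty u has one largest element and is counted at most once, so the factor |u| is replaced by
    [xi]. *)
Lemma S_err_bound2 (xi : R) : 1 <= xi ->
  (forall (s d' : nat) (u w : {fset nat}),
     (1 <= s)%N -> (1 <= d')%N ->
     (u `<=` irange 0 s)%fset -> (w `<=` irange s d')%fset ->
     G (u `|` w)%fset <= xi * (G u / (2 * zeta (alpha * lam)) ^+ #|` w|)) ->
  (S_err alpha gamma n z <=
  ((tau alpha lam / n%:R *
    (xi * \sum_(u <- fpowerset (irange 0 d) | u != fset0)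
       G u * (2 * zeta (alpha * lam)) ^+ #|` u|) * F) `^ lam^-1)%:E)%E.
Proof.
move=> xi1 hxi; have xi0 : 0 <= xi by exact: le_trans xi1.
pose phi (s : 'I_d) u := if s.+1 \in u then xi * G u else 0.
have phi0 s u : 0 <= phi s u by rewrite /phi; case: ifP => // _; rewrite mulr_ge0.
apply: (@S_err_bound (fun s => \sum_(u <- fpowerset (irange 0 s.+1))
  phi s u * (2 * zeta (alpha * lam)) ^+ #|` u|)).
- by move=> s; apply: sumr_ge0 => u _; rewrite mulr_ge0.
- move=> s k; rewrite -(@esum_supp _ _ s.+1)//.
  apply: (@le_trans _ _ (\esum_(h in agree_nz s k)
      (phi s (supp (@head_part d s h)) *
       \prod_j wt (alpha * lam) (@head_part d s h 0 j))%:E)%E).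
    apply: le_esum => h [_ hs]; rewrite lee_fin /phi.
    have -> : s.+1 \in supp (@head_part d s h).
      apply/suppP; exists ord_max; rewrite // mxE.
      by rewrite (_ : widen_ord _ _ = s); [exact/eqP|exact/val_inj].
    rewrite -{1}(@head_tailK d s h) /rinv supp_splice ?supp_tail_part//.
    rewrite prod_wt_splice ?supp_tail_part//.
    apply: ler_pM; rewrite ?mulr_ge0 ?prod_wt_ge0//.
      apply: le_trans (hxi s.+1 d _ _ _ _ (supp_irange _) (supp_tail_part _)) _ => //.
        by rewrite (leq_ltn_trans _ (ltn_ord s)).
      (* The power of [2 * zeta (alpha * lam)] in the denominator is at least 1 and is dropped;
         likewise the factors [wt] of the tail are at most 1. *)
      rewrite ler_wpM2l// ler_pdivrMr; last first.
        by rewrite exprn_gt0// (lt_le_trans ltr01)// zeta2_ge1.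
      by rewrite ler_peMr// exprn_ege1// zeta2_ge1.
    rewrite ler_piMr ?prod_wt_ge0// prodr_ile1// => j _; rewrite wt_ge0 wt_le1//.
    exact: ltW (lt_trans ltr01 b1).
  (* On [agree_nz s k] the tail is that of [k], so the head determines the vector. *)
  apply: (@le_esum_inj _ _ _ (@head_part d s) _ _ (fun g => (phi s (supp g) *
    \prod_j wt (alpha * lam) (g 0 j))%:E)) => [h h' [kh _] [kh' _] e|h _]; last first.
    exact: supp_irange.
  rewrite -(@head_tailK d s h) -(@head_tailK d s h') e; congr splice.
  by apply/rowP => j; rewrite !mxE; case: ltnP => // sj; rewrite -kh// -kh'.
(* The inner range is made independent of s so that the sums can be exchanged; the condition now
   says that s + 1 is the maximum of u. *)
- have -> : \sum_(s < d) \sum_(u <- fpowerset (irange 0 s.+1))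
      phi s u * (2 * zeta (alpha * lam)) ^+ #|` u| =
    \sum_(s < d) \sum_(u <- fpowerset (irange 0 d))
      if (s.+1 \in u) && (u `<=` irange 0 s.+1)%fset
      then xi * G u * (2 * zeta (alpha * lam)) ^+ #|` u| else 0.
    apply: eq_bigr => s _; rewrite -big_mkcond/=.
    under eq_bigr do rewrite /phi (fun_if (fun x => x * _)) mul0r.
    rewrite -big_mkcond/= -big_filter -[RHS]big_filter; apply: perm_big.
    apply: uniq_perm; rewrite ?filter_uniq ?fset_uniq// => u; rewrite !mem_filter !fpowersetE.
    rewrite -andbA; case: (s.+1 \in u) => //=.
    have [us|//] := boolP (u `<=` irange 0 s.+1)%fset; apply/esym.
    apply: fsubset_trans us _; apply/fsubsetP => i; rewrite !mem_irange => /andP[-> /= is_].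
    exact: leq_trans is_ _.
  rewrite exchange_big/= mulr_sumr [leRHS]big_mkcond/= ler_sum// => u _.
  rewrite -big_mkcond/=; apply: le_trans (sum_unique_le _ _) _.
  + by rewrite !mulr_ge0.
  + suff H (i j : 'I_d) : i.+1 \in u -> (u `<=` irange 0 j.+1)%fset -> (i <= j)%N.
      move=> i j /andP[iu ui] /andP[ju uj]; apply/val_inj/eqP.
      by rewrite eqn_leq !H.
    by move=> iu /fsubsetP/(_ _ iu); rewrite mem_irange.
  + case: existsP => [[s /andP[su _]]|_]; last by case: ifP; rewrite // !mulr_ge0.
    by rewrite ifT ?mulrA//; apply: contraTneq su => ->; rewrite inE.
Qed.

End cbc_bound.

Theorem theorem3p5 (R : realType) (alpha : R) (n d : nat)
    (gamma : {fset nat} -> R) (z : 'rV[int]_d)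
    (halpha : 1 < alpha) (hn : prime n) (hd : (1 <= d)%N)
    (hgamma : forall u : {fset nat}, 0 <= gamma u)
    (hgamma0 : gamma fset0 = 1)
    (hz : is_cbc alpha gamma n z) :
  forall lambda : R, alpha^-1 < lambda -> lambda <= 1 ->
    (S_err alpha gamma n z <=
      ((tau alpha lambda / n%:R *
        (\sum_(u <- fpowerset (irange 0 d) | u != fset0)
           #|` u|%:R * gamma u `^ lambda
             * (2 * zeta (alpha * lambda)) ^+ #|` u|) *
        (\sum_(u <- fpowerset (irange 0 d))
           gamma u `^ lambda * (2 * zeta (alpha * lambda)) ^+ #|` u|))
       `^ lambda^-1)%:E)%E
    /\
    (forall xi : R, 1 <= xi ->
      (forall (s d' : nat) (u w : {fset nat}),
         (1 <= s)%N -> (1 <= d')%N ->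
         (u `<=` irange 0 s)%fset -> (w `<=` irange s d')%fset ->
         gamma (u `|` w)%fset `^ lambda <=
           xi * (gamma u `^ lambda / (2 * zeta (alpha * lambda)) ^+ #|` w|)) ->
      (S_err alpha gamma n z <=
        ((tau alpha lambda * xi / n%:R *
          (\sum_(u <- fpowerset (irange 0 d) | u != fset0)
             gamma u `^ lambda * (2 * zeta (alpha * lambda)) ^+ #|` u|) *
          (\sum_(u <- fpowerset (irange 0 d))
             gamma u `^ lambda * (2 * zeta (alpha * lambda)) ^+ #|` u|))
         `^ lambda^-1)%:E)%E).
Proof.
move=> lambda hl l1; split; first exact: S_err_bound1.
move=> xi xi1 hxi; have := S_err_bound2 halpha hl l1 hn hgamma hz xi1 hxi.
by rewrite mulrA (mulrAC _ _ xi).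
Qed.
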